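(* Let $\lambda>-1$, let $w_L(x)=x^{\lambda}w_0(x)$, $x\in[0,+\infty)$, be a Laguerre-type weight function as in the context, and let $v_L(x):=-\ln w_L(x)$. Denote the Laguerre-type weight function with jump discontinuities by $$\widehat w(x;\vec t\,):=w_L(x)\left(\omega_0+\sum_{k=1}^{m}\omega_k\theta(x-t_k)\right),$$ where $w_L$ is independent of $\vec t=(t_1,\dots,t_m)$ with $0\le t_1<\cdots<t_m<\infty$, $\sum_{k=0}^{\ell}\omega_k\ge0$ for $0\le\ell\le m$, and $\theta(x)$ is the Heaviside step function, which is $1$ for $x>0$ and $0$ otherwise. The associated monic orthogonal polynomials $\{P_n\}$, with $h_n$ and $\beta_n$ as in the context, satisfy the ladder operators $$P_n'(z)=-B_n(z)P_n(z)+\beta_nA_n(z)P_{n-1}(z),$$ $$P_{n-1}'(z)=\bigl(B_n(z)+v_L'(z)\bigr)P_{n-1}(z)-A_{n-1}(z)P_n(z)$$ for $n\ge0$, with $A_{-1}(z)=B_0(z):=0$ and $$A_n(z)=\frac1z\left[\frac1{h_n}\int_0^{\infty}\frac{zv_L'(z)-xv_L'(x)}{z-x}P_n^2(x)\widehat w(x;\vec t\,)\,dx-\sum_{k=1}^{m}R_{n,k}\right]+\sum_{k=1}^{m}\frac{R_{n,k}}{z-t_k},\qquad n\ge0,$$ $$B_n(z)=\frac1z\left[\frac1{h_{n-1}}\int_0^{\infty}\frac{zv_L'(z)-xv_L'(x)}{z-x}P_{n-1}(x)P_n(x)\widehat w(x;\vec t\,)\,dx-\sum_{k=1}^{m}r_{n,k}-n\right]+\sum_{k=1}^{m}\frac{r_{n,k}}{z-t_k},\qquad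 n\ge1,$$ where, for $k=1,\dots,m$, $$R_{n,k}(\vec t\,):=\frac{\omega_kw_L(t_k)P_n^2(t_k)}{h_n},\qquad r_{n,k}(\vec t\,):=\frac{\omega_kw_L(t_k)P_n(t_k)P_{n-1}(t_k)}{h_{n-1}}.$$
   Context: Weight: $w_0(x)$ is a continuously differentiable function, $w_0(x)>0$, and $w_0(x)$ is bounded at the endpoint $0$ of $[0,+\infty)$; all moments $\int_0^{\infty}x^jw_L(x)\,dx$, $j=0,1,\dots$, are finite; and $\lim_{x\to+\infty}w_L(x)\pi(x)=0$ for an arbitrary polynomial $\pi$. Polynomials: $P_0(x):=1$, $P_{-1}(x):=0$, and for $j\ge1$ $P_j$ is the monic polynomial of degree $j$ such that $\int_0^{\infty}P_i(x)P_j(x)\widehat w(x;\vec t\,)\,dx=h_j\delta_{ij}$ for $i,j\ge0$ ($\delta_{ij}$ is the Kronecker delta). $\beta_j=h_j/h_{j-1}$ for $j\ge1$; the term containing $\beta_0$ is multiplied by $P_{-1}=0$. The dependence of $P_n,h_n$ on $\vec t$ is suppressed. A prime denotes differentiation.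
   Formalization: For real z>0, z≠t_k, it is also assumed that (zv_L'(z)−xv_L'(x))/(z−x)·ŵ(x) is integrable in x near x=z (automatic if w_0 is C²): for w_0 merely C¹ the integrals in A_n(z), B_n(z) can diverge there, leaving them undefined. *)

(* Defs.v *)
From HB Require Import structures.
From mathcomp Require Import all_boot all_order all_algebra.
From mathcomp Require Import all_classical all_reals all_analysis.
Set Implicit Arguments.
Unset Strict Implicit.
Unset Printing Implicit Defensive.
Import Order.TTheory GRing.Theory Num.Theory.
Import numFieldNormedType.Exports.
Local Open Scope classical_set_scope.
Local Open Scope ring_scope.

                                                            
Definition preceding (V : nmodType) (u : nat -> V) (n : nat) : V :=
  if n is k.+1 then u k else 0.

Definition heaviside (R : realType) (x : R) : R := (0 < x)%R%:R.

Definition laguerre_weight (R : realType) (lam : R) (w0 : R -> R) (x : R) : R :=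
  x `^ lam * w0 x.

Definition potential (R : realType) (w : R -> R) (x : R) : R := - ln (w x).

                                                                          
                                                
Definition laguerre_type (R : realType) (lam : R) (w0 : R -> R) : Prop :=
  [/\ (forall x : R, 0 < x -> [/\ 0 < w0 x, derivable w0 x 1 &
                                 {for x, continuous (derive1 w0)}]),
      bounded_near w0 0^'+,
      (forall j : nat, (@lebesgue_measure R).-integrable `[0, +oo[
         (EFin \o (fun x => x ^+ j * laguerre_weight lam w0 x))) &
      (forall p : {poly R},
         laguerre_weight lam w0 x * p.[x] @[x --> +oo] --> 0)].

                                                                              
                                                                        
Definition jump_weight (R : realType) (w : R -> R) (m : nat)
    (omega : 'I_m.+1 -> R) (t : 'I_m -> R) (x : R) : R :=
  w x * (omega ord0 +
         \sum_(k < m) omega (lift ord0 k) * heaviside (x - t k)).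

                                                                      
                                                              
Definition monic_orthogonal (R : realType) (wh : R -> R)
    (P : nat -> {poly R}) (h : nat -> R) : Prop :=
  [/\ (forall j, P j \is monic /\ size (P j) = j.+1),
      (forall j, h j != 0) &
      (forall i j, \int[@lebesgue_measure R]_(x in `[0, +oo[)
                     ((P i).[x] * (P j).[x] * wh x) = h j * (i == j)%:R)].

                                                                         
Definition beta (R : realType) (h : nat -> R) (n : nat) : R :=
  if n is k.+1 then h n / h k else 0.

                                                                               
                                                                            
                                                                       
Definition improper_seg (R : realType) (f : R -> R) (ab : R * R) : R :=
  \int[@lebesgue_measure R]_(x in `[ab.1, ab.2]) f x.

Definition improper_filter (R : realType) : set_system (R * R) :=
  filter_prod (0 : R)^'+ (pinfty_nbhs R).

Definition improper_cvg (R : realType) (f : R -> R) : Prop :=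
  (forall a b : R, 0 < a -> a < b ->
     (@lebesgue_measure R).-integrable `[a, b] (EFin \o f)) /\
  cvg (improper_seg f @ @improper_filter R).

Definition improper_int (R : realType) (f : R -> R) : R :=
  lim (improper_seg f @ @improper_filter R).

Definition ladder_kernel (R : realType) (v : R -> R) (z x : R) : R :=
  (z * derive1 v z - x * derive1 v x) / (z - x).

Section LadderCoefficients.
Variables (R : realType) (w : R -> R) (m : nat).
Variables (omega : 'I_m.+1 -> R) (t : 'I_m -> R).
Variables (P : nat -> {poly R}) (h : nat -> R).

                                                                             
                                                                              
                                                                       
Definition jumpR (n : nat) (k : 'I_m) : R :=
  omega (lift ord0 k) * w (t k) * (P n).[t k] ^+ 2 / h n.

Definition jumpr (n : nat) (k : 'I_m) : R :=
  omega (lift ord0 k) * w (t k) * (P n).[t k] * (preceding P n).[t k] / preceding h n.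

Definition integrandA (n : nat) (z x : R) : R :=
  ladder_kernel (potential w) z x * (P n).[x] ^+ 2 * jump_weight w omega t x.

Definition integrandB (n : nat) (z x : R) : R :=
  ladder_kernel (potential w) z x * (preceding P n).[x] * (P n).[x] *
  jump_weight w omega t x.

Definition ladderA (n : nat) (z : R) : R :=
  z^-1 * ((h n)^-1 * improper_int (integrandA n z) - \sum_(k < m) jumpR n k) +
  \sum_(k < m) jumpR n k / (z - t k).

Definition ladderB (n : nat) (z : R) : R :=
  if n is n'.+1 then
    z^-1 * ((h n')^-1 * improper_int (integrandB n z)
            - \sum_(k < m) jumpr n k - n%:R) +
    \sum_(k < m) jumpr n k / (z - t k)
  else 0.

End LadderCoefficients.

(* Main.v *)
Require Import Defs.
From HB Require Import structures.
From mathcomp Require Import all_boot all_order all_algebra.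
From mathcomp Require Import all_classical all_reals all_analysis measurable_realfun.
From mathcomp Require Import ring lra.
Set Implicit Arguments.
Unset Strict Implicit.
Unset Printing Implicit Defensive.
Import Order.TTheory GRing.Theory Num.Theory.
Import numFieldNormedType.Exports.
Local Open Scope classical_set_scope.
Local Open Scope ring_scope.

(* Put [L f] for the integral of [f * wh] over [0, +oo[ and [M f] for the
   improper integral of [ladder_kernel v z x * f x * wh x].  On [(z - x) S] the
   factor [z - x] cancels the denominator of the kernel and [v' w = - w'], so
   integration by parts between the jumps gives
     [M ((z - x) S) = z v'(z) L S - L ((x S)') - \sum_k omega_k t_k S(t_k) w(t_k)];
   adding [\sum_k omega_k w(t_k) t_k f(t_k) / (z - t_k)] to [M f] absorbs the sum,
   and the values of this corrected [M] at [P_n^2] and [P_(n-1) P_n] are what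
   enters [A_n(z)] and [B_n(z)].  Both ladder relations are then the identity for
   [S = T P_n] and [S = T P_(n-1)], where
     [(z - x) T = P_(n-1)(z) P_n - P_n(z) P_(n-1)],
   because [L (T f) = - h_(n-1) f(z)] for [f] of degree less than [n].
   That [M f] exists follows from [1 = chi + (z - x) f] with [f] of class [C^1] and
   [chi] supported in the ball around [z] where the kernel is assumed integrable. *)

(** * Improper integrals over ]0, +oo[ *)

(** Existence and value sit in one predicate, so that both pass together through sums, multiples and
    pointwise equality; [improper_cvg] and [improper_int] are read off at the end. *)
Definition has_improper_int (R : realType) (f : R -> R) (l : R) : Prop :=
  (forall a b : R, 0 < a -> a < b ->
     (@lebesgue_measure R).-integrable `[a, b] (EFin \o f)) /\
  improper_seg f @ @improper_filter R --> l.

Section ImproperIntegrals.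
Context {R : realType}.
Notation mu := (@lebesgue_measure R).
Implicit Types (f g F : R -> R) (l k : R).

#[local] Instance improper_filter_proper : ProperFilter (@improper_filter R).
Proof. exact: filter_prod_proper. Qed.

Lemma near_improper_le (d : R) :
  \forall ab \near @improper_filter R, 0 < ab.1 /\ Num.max ab.1 d < ab.2.
Proof.
(* The number 1 separates the endpoints: a < 1 < b. *)
exists ([set x : R | 0 < x < 1], [set x : R | Num.max 1 d < x]).
  split => /=.
  - near=> x; apply/andP; split; near: x; first exact: nbhs_right_gt.
    exact: nbhs_right_lt.
  - by exists (Num.max 1 d); split; rewrite ?num_real.
move=> [a b] [/= /andP[a0 a1]]; rewrite gt_max => /andP[b1 bd].
by rewrite a0 gt_max bd andbT (lt_trans a1).
Unshelve. all: by end_near. Qed.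

Lemma has_improper_int_cvg f l : has_improper_int f l -> improper_cvg f.
Proof. by move=> [int_f fl]; split=> //; apply/cvg_ex; exists l. Qed.

Lemma has_improper_intE f l : has_improper_int f l -> improper_int f = l.
Proof. by move=> [_ fl]; exact/cvg_lim. Qed.

Lemma has_improper_int_ext f g l : (forall x, 0 < x -> f x = g x) ->
  has_improper_int f l -> has_improper_int g l.
Proof.
move=> fg [int_f fl].
have in_fg (a b : R) : 0 < a -> {in `[a, b], f =1 g}.
  by move=> a0 x; rewrite in_itv/= => /andP[ax _]; exact/fg/(lt_le_trans a0).
split=> [a b a0 ab|].
  apply: eq_integrable (int_f a b a0 ab) => // x; rewrite inE/= => xab.
  by rewrite (in_fg a b).
apply: cvg_trans fl; apply: near_eq_cvg.
have := near_improper_le 0; apply: filterS => -[a b] /= [a0 _].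
by apply: eq_Rintegral => x; rewrite inE/= => xab; rewrite (in_fg a b).
Qed.

Lemma has_improper_intD f g l k : has_improper_int f l ->
  has_improper_int g k -> has_improper_int (fun x => f x + g x) (l + k).
Proof.
move=> [int_f fl] [int_g gk]; split=> [a b a0 ab|].
  by apply: (integrableD _ (int_f a b a0 ab) (int_g a b a0 ab)).
apply: cvg_trans (cvgD fl gk); apply: near_eq_cvg.
have := near_improper_le 0; apply: filterS => -[a b] /= [a0].
rewrite gt_max => /andP[ab _].
by rewrite /improper_seg RintegralD//; [exact: int_f|exact: int_g].
Qed.

Lemma has_improper_intZ f l k : has_improper_int f l ->
  has_improper_int (fun x => k * f x) (k * l).
Proof.
move=> [int_f fl]; split=> [a b a0 ab|].
  by apply: (integrableZl _ _ (int_f a b a0 ab)).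
apply: cvg_trans (cvgM (cvg_cst k) fl); apply: near_eq_cvg.
have := near_improper_le 0; apply: filterS => -[a b] /= [a0].
rewrite gt_max => /andP[ab _].
by rewrite /improper_seg RintegralZl//; exact: int_f.
Qed.

Lemma has_improper_int0 : has_improper_int (fun=> 0 : R) 0.
Proof.
split=> [a b _ _|]; first exact: integrable0.
rewrite (_ : improper_seg _ = cst 0); first exact: cvg_cst.
by apply/funext => ab; rewrite /improper_seg Rintegral_cst// mul0r.
Qed.

Lemma has_improper_int_sum (I : finType) (f : I -> R -> R) (l : I -> R) :
  (forall i, has_improper_int (f i) (l i)) ->
  has_improper_int (fun x => \sum_i f i x) (\sum_i l i).
Proof.
move=> fl.
rewrite -(_ : \sum_i f i = fun x => \sum_i f i x)//; last first.
  by apply/funext => x; rewrite fct_sumE.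
elim/big_ind2 : _ => // [|? ? ? ? h1 h2]; first exact: has_improper_int0.
exact: has_improper_intD.
Qed.

(** The two ends have separate functions [F] and [G] because a jump inside the segment changes what
    the left end contributes; [d] lets the formula start only once b has passed the jump. *)
Lemma has_improper_int_primitive f F G (d l k : R) :
  (forall a b : R, 0 < a -> a < b -> mu.-integrable `[a, b] (EFin \o f)) ->
  F x @[x --> +oo] --> l -> G x @[x --> 0^'+] --> k ->
  (forall a b : R, 0 < a -> Num.max a d < b ->
    \int[mu]_(x in `[a, b]) f x = F b - G a) ->
  has_improper_int f (l - k).
Proof.
move=> int_f Fl Gk fFG; split=> //.
have Fl2 : F ab.2 @[ab --> @improper_filter R] --> l.
  by apply: (cvg_comp _ _ _ Fl); exact: cvg_snd.
have Gk1 : G ab.1 @[ab --> @improper_filter R] --> k.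
  by apply: (cvg_comp _ _ _ Gk); exact: cvg_fst.
apply: cvg_trans (cvgB Fl2 Gk1); apply: near_eq_cvg.
have := near_improper_le d; apply: filterS => -[a b] /= [a0 adb].
by rewrite /improper_seg fFG.
Qed.

(** Along any sequence tending to +oo the truncations of [f] converge pointwise and are dominated by
    |f|. *)
Lemma cvg_Rintegral_itvy f : mu.-integrable `[0, +oo[ (EFin \o f) ->
  \int[mu]_(x in `[0, b]) f x @[b --> +oo] --> \int[mu]_(x in `[0, +oo[) f x.
Proof.
move=> int_f; apply/cvg_pinftyP => u uy.
have mf := measurable_int _ int_f.
have sub n : `[0, u n] `<=` `[0%R, +oo[.
  by move=> x /=; rewrite !in_itv/= andbT => /andP[].
pose g n := EFin \o (f \_ (`[0, u n])).
have [] := @dominated_convergence _ _ _ mu `[0%R, +oo[ _ g (EFin \o f)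
  (abse \o (EFin \o f)).
- by [].
- move=> n; apply/measurable_EFinP.
  apply/(@measurable_restrict _ _ (measurableTypeR R) (measurableTypeR R)) => //.
  by rewrite setIidr//; apply/measurable_EFinP; exact: measurable_funS mf.
- exact: mf.
- apply: aeW => x /=; rewrite in_itv/= andbT => x0.
  apply: cvg_near_cst.
  move/cvgryPge : uy => /(_ x); apply: filterS => n xn.
  by rewrite /g/= patchE ifT// inE/= in_itv/= x0.
- exact: integrable_abse.
- apply: aeW => x n /= _; rewrite patchE; case: ifPn => //= _.
  by rewrite normr0 lee_fin.
move=> _ _.
rewrite (_ : [sequence _]_n =
  fun n => (\int[mu]_(x in `[0%R, u n]) (f x)%:E)%E); last first.
  apply/funext => n /=.
  by rewrite /g -restrict_EFin -integral_mkcondr setIidr.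
rewrite -[X in _ --> X -> _]fineK; first by move/fine_cvgP => [].
exact: integrable_fin_num.
Qed.

(** The truncated integral is J b - J a, and J a tends to 0 by continuity of the integral in its
    upper limit. *)
Lemma has_improper_int_integrable f : mu.-integrable `[0, +oo[ (EFin \o f) ->
  has_improper_int f (\int[mu]_(x in `[0, +oo[) f x).
Proof.
move=> int_f.
have int_itv (a b : R) : 0 <= a -> mu.-integrable `[a, b] (EFin \o f).
  move=> a0; apply: integrableS int_f => // x /=; rewrite !in_itv/= andbT.
  by move=> /andP[+ _]; exact: le_trans.
pose J b := \int[mu]_(x in `[0, b]) f x.
have J0 : J a @[a --> 0^'+] --> 0.
  apply/cvg_at_right_filter.
  exact: (@parameterized_integral_cvg_left _ 0 1 f ltr01 (int_itv _ _ _)).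
rewrite -[X in has_improper_int _ X]subr0.
apply: (@has_improper_int_primitive _ _ J 0 _ _ _ (cvg_Rintegral_itvy int_f) J0).
  by move=> a b /ltW a0 _; exact: int_itv.
move=> a b a0; rewrite gt_max => /andP[/ltW ab b0].
rewrite [RHS]Rintegral_itvB ?bnd_simp ?(ltW a0)//; last exact: int_itv.
rewrite Rintegral_itv_obnd_cbnd//.
apply: integrableS (int_itv a b (ltW a0)) => //; exact: subset_itv_oc_cc.
Qed.

Lemma itvcc_setI_gt (a b c : R) : a <= c ->
  `[a, b] `&` `]c, +oo[ = `]c, b]%classic.
Proof.
move=> ac; apply/seteqP; split=> x /=; rewrite !in_itv/= andbT.
  by move=> [/andP[_ ->] ->].
by move=> /andP[cx ->]; rewrite cx (le_trans ac (ltW cx)).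
Qed.

Lemma measurable_heaviside (c : R) (D : set (measurableTypeR R)) :
  measurable_fun D (fun x : measurableTypeR R => heaviside (x - c)).
Proof.
rewrite (_ : (fun _ => _) = \1_(`]c, +oo[%classic)); first exact: measurable_indic.
apply/funext => x; rewrite indicE /heaviside subr_gt0; congr ((nat_of_bool _)%:R).
by apply/idP/idP; rewrite inE/= in_itv/= andbT.
Qed.

Lemma integrable_heavisideM (i : interval R) f (c : R) :
  mu.-integrable [set` i] (EFin \o f) ->
  mu.-integrable [set` i] (EFin \o (fun x => f x * heaviside (x - c))).
Proof.
move=> int_f.
have h1 : [bounded heaviside (x - c) | x in [set` i]%classic].
  exists 1; split; first exact: num_real.
  move=> x x1 y _; rewrite /= /heaviside; case: ltP => _; rewrite ?normr1 ?normr0.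
    exact: ltW.
  by rewrite (le_trans ler01)// ltW.
have := @integrableMl _ (measurableTypeR R) _ mu _ (measurable_itv _) _ _ int_f
  (@measurable_heaviside c _) h1.
by apply: eq_integrable => // x _ /=; rewrite EFinM.
Qed.

Lemma continuous_integrable f (a b : R) :
  (forall x, a <= x <= b -> {for x, continuous f}) ->
  mu.-integrable `[a, b] (EFin \o f).
Proof.
move=> cf; apply: continuous_compact_integrable; first exact: segment_compact.
by apply: continuous_in_subspaceT => x; rewrite inE/= in_itv; exact: cf.
Qed.

Lemma Rintegral_derive1 F (a b : R) : a < b ->
  (forall x, a <= x <= b -> derivable F x 1 /\ {for x, continuous (derive1 F)}) ->
  \int[mu]_(x in `[a, b]) derive1 F x = F b - F a.
Proof.
move=> ab dF.
have cF x : a <= x <= b -> {for x, continuous F}.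
  by move=> /dF[dFx _]; exact/differentiable_continuous/derivable1_diffP.
rewrite /Rintegral (@continuous_FTC2 _ _ F)//.
  by apply: continuous_in_subspaceT => x; rewrite inE/= in_itv => /dF[].
split.
- by move=> x; rewrite in_itv/= => /andP[/ltW ax /ltW xb]; apply: (dF x _).1; rewrite ax.
- by apply/cvg_at_right_filter/cF; rewrite lexx ltW.
- by apply/cvg_at_left_filter/cF; rewrite lexx ltW.
Qed.

(** The truncated integral is F(b) - F(max(a, c)), because the step erases everything left of c. The
    derivative is controlled only on x > 0, so c = 0 needs the limit of [F] at 0 as a hypothesis. *)
Lemma has_improper_int_derive1_heaviside F (c : R) : 0 <= c ->
  (forall x, 0 < x -> derivable F x 1 /\ {for x, continuous (derive1 F)}) ->
  F x @[x --> 0^'+] --> F 0 -> F x @[x --> +oo] --> 0 ->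
  has_improper_int (fun x => derive1 F x * heaviside (x - c)) (- F c).
Proof.
move=> c0 dF F0 Foo.
have int_f (a b : R) : 0 < a -> mu.-integrable `[a, b] (EFin \o derive1 F).
  move=> a0; apply: continuous_integrable => x /andP[ax _].
  by apply: (dF _ _).2; exact: lt_le_trans ax.
have int_fc (a b : R) : 0 < a ->
    mu.-integrable `[a, b] (EFin \o (fun x => derive1 F x * heaviside (x - c))).
  by move=> a0; apply: integrable_heavisideM => //; exact: int_f.
have int_itv (a b : R) : 0 < a -> a < b ->
    \int[mu]_(x in `[a, b]) derive1 F x = F b - F a.
  move=> a0 ab; apply: Rintegral_derive1 => // x /andP[ax _].
  by apply: dF; exact: lt_le_trans ax.
rewrite -[- F c]add0r.
apply: (@has_improper_int_primitive _ F (fun a => F (Num.max a c)) c) => //.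
- by move=> a b a0 _; exact: int_fc.
- move: c0; rewrite le_eqVlt => /predU1P[<-|c0].
    apply: cvg_trans F0; apply: near_eq_cvg; near=> x.
    by rewrite max_l.
  by apply: cvg_near_cst; near=> x; rewrite max_r//; near: x; exact: nbhs_right_le.
move=> a b a0; rewrite gt_max => /andP[ab cb].
(* If c < a the step is 1 on the whole segment; otherwise only ]c, b] contributes. *)
have [ca|ac] := ltP c a.
  rewrite -int_itv//.
  apply: eq_Rintegral => x; rewrite inE/= in_itv/= => /andP[ax _].
  by rewrite /heaviside subr_gt0 (lt_le_trans ca)// mulr1.
have c0' := lt_le_trans a0 ac.
rewrite -int_itv//.
rewrite -[RHS]Rintegral_itv_obnd_cbnd; last first.
  by apply: integrableS (int_f c b c0') => //; exact: subset_itv_oc_cc.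
rewrite -(itvcc_setI_gt b ac) Rintegral_mkcondr.
apply: eq_Rintegral => x _; rewrite patchE /heaviside subr_gt0.
case: ifPn; first by rewrite inE/= in_itv/= andbT => ->; rewrite mulr1.
by rewrite notin_setE/= in_itv/= andbT => /negP/negbTE ->; rewrite mulr0.
Unshelve. all: by end_near. Qed.

End ImproperIntegrals.

(** * Orthogonal polynomials and the Christoffel-Darboux kernel *)

Lemma size_mulXsubC (F : idomainType) (p : {poly F}) z : p != 0 ->
  size (p * ('X - z%:P)) = (size p).+1.
Proof. by move=> p0; rewrite size_Mmonic ?monicXsubC// size_XsubC addn2. Qed.

Section OrthogonalPolynomials.
Variables (F : fieldType) (L : {scalar {poly F}}).
Variables (P : nat -> {poly F}) (h : nat -> F).
Hypothesis P_monic : forall j, P j \is monic.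
Hypothesis size_P : forall j, size (P j) = j.+1.
Hypothesis h_neq0 : forall j, h j != 0.
Hypothesis P_ortho : forall i j, L (P i * P j) = h j * (i == j)%:R.

Let coefPn n : (P n)`_n = 1.
Proof. by have /monicP := P_monic n; rewrite lead_coefE size_P. Qed.

Lemma size_sub_lead (q : {poly F}) n : (size q <= n.+1)%N ->
  (size (q - q`_n *: P n)%R <= n)%N.
Proof.
move=> sq; apply/leq_sizeP => j; rewrite leq_eqVlt => /predU1P[<-|nj].
  by rewrite coefB coefZ coefPn mulr1 subrr.
rewrite coefB coefZ [q`_j]nth_default ?(leq_trans sq)//.
by rewrite [(P n)`_j]nth_default ?size_P// mulr0 subr0.
Qed.

Lemma ortho_lt n (q : {poly F}) : (size q <= n)%N -> L (P n * q) = 0.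
Proof.
(* The size bound k is separated from n, so that the induction removes one leading term at a time
   with P_n fixed. *)
suff H k : (k <= n)%N -> forall q : {poly F}, (size q <= k)%N -> L (P n * q) = 0.
  by move=> sq; exact: (H n).
elim: k => [|k IH] kn {}q sq.
  by move: sq; rewrite leqn0 size_poly_eq0 => /eqP ->; rewrite mulr0 linear0.
rewrite -(subrK (q`_k *: P k) q) mulrDr linearD/= (IH (ltnW kn))//; last first.
  exact: size_sub_lead.
by rewrite -scalerAr linearZ/= P_ortho gtn_eqF// !mulr0 addr0.
Qed.

Lemma ortho_coef n (q : {poly F}) : (size q <= n.+1)%N ->
  L (P n * q) = q`_n * h n.
Proof.
move=> sq; rewrite -[in LHS](subrK (q`_n *: P n) q) mulrDr linearD/=.
rewrite ortho_lt ?size_sub_lead// add0r -scalerAr linearZ/= P_ortho.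
by rewrite eqxx mulr1.
Qed.

(** If P_n = V (X - z) and P_(n+1) = U (X - z), then P_n U = V P_(n+1). The left side has integral
    h_n, as U has degree n and leading coefficient 1; the right side has integral 0, as V has degree
    below n + 1. *)
Lemma ortho_no_common_root n z : (P n).[z] = 0 -> (P n.+1).[z] = 0 -> False.
Proof.
move=> /eqP/factor_theorem[V PV] /eqP/factor_theorem[U PU].
have sz (W : {poly F}) k : size (W * ('X - z%:P)) = k.+1 -> size W = k.
  have [->|W0] := eqVneq W 0; first by rewrite mul0r size_poly0.
  by rewrite size_mulXsubC// => -[].
have sU : size U = n.+1 by apply: sz; rewrite -PU size_P.
have sV : size V = n by apply: sz; rewrite -PV size_P.
have /eqP := h_neq0 n; apply.
have := ortho_coef (n := n) (q := U); rewrite sU leqnn => /(_ isT).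
rewrite (_ : U`_n = 1) ?mul1r; last first.
  have := coefPn n.+1.
  by rewrite PU mulrBr coefB coefMX coefMC/= (@nth_default _ _ _ n.+1) ?sU// mul0r subr0.
move=> <-; rewrite PV -mulrA [_ * U]mulrC -PU mulrC ortho_lt// sV.
exact: leqnSn.
Qed.

(* [T] is minus the Christoffel-Darboux kernel, up to the factor [h n]. *)
Lemma exists_kernel n z : exists T : {poly F},
  [/\ (size T <= n.+1)%N, T`_n = - (P n).[z],
      (z%:P - 'X) * T = (P n).[z] *: P n.+1 - (P n.+1).[z] *: P n &
      forall f : {poly F}, (size f <= n.+2)%N ->
        L (T * f) = - h n * f.[z] + f`_n.+1 * (P n.+1).[z] * h n].
Proof.
set N := _ *: _ - _.
have N0 : root N z.
  by apply/rootP; rewrite /N hornerD hornerN !hornerZ mulrC subrr.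
have sN : (size N <= n.+2)%N.
  rewrite (leq_trans (size_polyD _ _))// size_polyN geq_max.
  by rewrite !(leq_trans (size_scale_leq _ _)) ?size_P.
have /factor_theorem[U NU] := N0.
have sdiv (W : {poly F}) k : (size (W * ('X - z%:P))%R <= k.+1)%N -> (size W <= k)%N.
  have [->|W0] := eqVneq W 0; first by rewrite size_poly0.
  by rewrite size_mulXsubC.
have sU : (size U <= n.+1)%N by apply: sdiv; rewrite -NU.
have coefdiv (W : {poly F}) k : (size W <= k.+1)%N ->
    (W * ('X - z%:P))`_k.+1 = W`_k.
  move=> sW; rewrite mulrBr coefB coefMX coefMC/=.
  by rewrite (@nth_default _ _ _ k.+1) ?mul0r ?subr0.
have NT : (z%:P - 'X) * - U = N by rewrite NU mulrN -mulNr opprB mulrC.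
(* Write f = f(z) + (X - z) q: the factor X - z turns [U] back into [N], and orthogonality evaluates
   L (N q). *)
have Lf (f : {poly F}) : (size f <= n.+2)%N ->
    L (- U * f) = f.[z] * L (- U) + f`_n.+1 * (P n.+1).[z] * h n.
  move=> sf.
  have /factor_theorem[q fq] : root (f - (f.[z])%:P) z.
    by apply/rootP; rewrite hornerD hornerN hornerC subrr.
  have sfz : (size (f - (f.[z])%:P)%R <= n.+2)%N.
    rewrite (leq_trans (size_polyD _ _))// size_polyN geq_max sf.
    by rewrite (leq_trans (size_polyC_leq1 _)).
  have sq : (size q <= n.+1)%N by apply: sdiv; rewrite -fq.
  have qn : q`_n = f`_n.+1 by rewrite -(coefdiv q)// -fq coefB coefC subr0.
  rewrite -[in LHS](subrK (f.[z])%:P f) fq mulrDr linearD/= addrC; congr (_ + _).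
    by rewrite mulrC mul_polyC linearZ.
  rewrite (_ : - U * _ = - (N * q)); last by rewrite -NT; ring.
  rewrite linearN/= /N mulrBl -!scalerAl linearB/= !linearZ/=.
  by rewrite ortho_lt// ortho_coef// qn; ring.
(* Taking f = P_n and f = P_(n+1) in [Lf] gives (L(-U) + h_n) P_n(z) = 0 and (L(-U) + h_n)
   P_(n+1)(z) = 0, and the two values at z do not both vanish. *)
have c : L (- U) = - h n.
  have Pn := Lf (P n); have Pn1 := Lf (P n.+1).
  rewrite !size_P leqnSn leqnn in Pn Pn1.
  have {}Pn := Pn isT; have {}Pn1 := Pn1 isT.
  rewrite [(P n)`_n.+1]nth_default ?size_P// !mul0r addr0 in Pn.
  rewrite coefPn mul1r in Pn1.
  rewrite mulrC ortho_coef ?size_polyN// coefN in Pn.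
  rewrite mulrC ortho_lt ?size_polyN// in Pn1.
  have Un : U`_n = (P n).[z].
    rewrite -(coefdiv U)// -NU coefB !coefZ coefPn [(P n)`_n.+1]nth_default ?size_P//.
    by rewrite mulr1 mulr0 subr0.
  have [Pnz|Pnz] := eqVneq (P n).[z] 0; last first.
    by apply: (mulfI Pnz); rewrite -Pn Un; ring.
  have [Pn1z|Pn1z] := eqVneq (P n.+1).[z] 0.
    by case: (ortho_no_common_root Pnz Pn1z).
  by apply: (mulfI Pn1z); apply/eqP; rewrite -subr_eq0 Pn1; apply/eqP; ring.
exists (- U); split => //; first by rewrite size_polyN.
- rewrite coefN -(coefdiv U)// -NU coefB !coefZ coefPn [(P n)`_n.+1]nth_default ?size_P//.
  by rewrite mulr1 mulr0 subr0.
- by move=> f sf; rewrite Lf// c mulrC.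
Qed.

Variables (z zv : F) (M : {scalar {poly F}}).
Hypothesis M_mul : forall S : {poly F},
  M ((z%:P - 'X) * S) = zv * L S - L ('X * S)^`().

Let coef_derivXM (S : {poly F}) j : (('X * S)^`())`_j = S`_j *+ j.+1.
Proof. by rewrite coef_deriv coefXM. Qed.

Let size_derivXM n (S : {poly F}) : (size S <= n.+1)%N ->
  (size (('X * S)^`())%R <= n.+1)%N.
Proof.
move=> sS; apply/leq_sizeP => j nj.
by rewrite coef_derivXM nth_default ?mul0rn// (leq_trans sS).
Qed.

Let size_Xderiv n : (size ('X * (P n)^`())%R <= n.+1)%N.
Proof.
apply/leq_sizeP => -[//|j nj].
by rewrite coefXM coef_deriv nth_default ?size_P// mul0rn.
Qed.

(** With Q = P_j, the first term is evaluated by orthogonality to P_j and the second by the kernel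
    property of [T]. *)
Let deriv_XM (T Q : {poly F}) :
  ('X * (T * Q))^`() = Q * ('X * T)^`() + T * ('X * Q^`()).
Proof. by rewrite !derivM; ring. Qed.

(** Here [zv] stands for z v'(z). In [M_mul] with S = T P_(n+1), the degree of [T] is at most n, so
    both L (T P_(n+1)) and the term with (X T)' vanish; this is why v' is absent. *)
Lemma lowering_identity n :
  z * h n * ((P n.+1)^`()).[z] =
  - (M (P n * P n.+1) - n.+1%:R * h n) * (P n.+1).[z]
  + M (P n.+1 ^+ 2) * (P n).[z].
Proof.
have [T [sT Tn NT LT]] := exists_kernel n z.
have := M_mul (T * P n.+1).
rewrite deriv_XM linearD/= mulrA NT mulrBl -!scalerAl linearB/= !linearZ/= -expr2.
rewrite [T * P _]mulrC !ortho_lt ?size_derivXM// LT ?size_Xderiv//.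
rewrite hornerM hornerX coefXM/= coef_deriv coefPn => E.
(* Goal and [E] are both brought to the form [_ = 0]; the sum of their left sides vanishes
   identically. *)
apply/eqP; rewrite -subr_eq0; move/eqP: E; rewrite -subr_eq0 => /eqP E.
by rewrite -[X in X == 0]addr0 -{}[X in _ + X == 0]E; apply/eqP; ring.
Qed.

(** With S = T P_n the degrees now match, so the top coefficient -P_n(z) of [T] survives: it brings
    in [zv] through L (T P_n) and n + 1 through (X T)'. *)
Lemma raising_identity n :
  z * h n * ((P n)^`()).[z] =
  (M (P n * P n.+1) + (zv - n.+1%:R) * h n) * (P n).[z]
  - M (P n ^+ 2) * (P n.+1).[z].
Proof.
have [T [sT Tn NT LT]] := exists_kernel n z.
have := M_mul (T * P n).
rewrite deriv_XM linearD/= mulrA NT mulrBl -!scalerAl linearB/= !linearZ/= -expr2.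
rewrite [T * P _]mulrC !ortho_coef ?size_derivXM// LT ?(leq_trans (size_Xderiv _))//.
rewrite coef_derivXM Tn.
rewrite hornerM hornerX coefXM/= coef_deriv [(P n)`_n.+1]nth_default ?size_P//.
rewrite [P n.+1 * P n]mulrC => E.
apply/eqP; rewrite -subr_eq0; move/eqP: E; rewrite -subr_eq0 => /eqP E.
by rewrite -[X in X == 0]addr0 -{}[X in _ + X == 0]E; apply/eqP; ring.
Qed.

End OrthogonalPolynomials.

(** * Auxiliary facts on integrability, derivatives and limits *)

Lemma eq_integrable_itv (R : realType) (i : interval R) (f g : R -> R) :
  {in i, f =1 g} -> (@lebesgue_measure R).-integrable [set` i] (EFin \o f) ->
  (@lebesgue_measure R).-integrable [set` i] (EFin \o g).
Proof.
move=> fg; have := @eq_integrable _ (measurableTypeR R) _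
  (@lebesgue_measure R) _ (measurable_itv i) (EFin \o f) (EFin \o g).
by apply=> x /[1!inE]/= xi; rewrite fg.
Qed.

Lemma integrable_scalel (R : realType) (i : interval R) (k : R) (f : R -> R) :
  (@lebesgue_measure R).-integrable [set` i] (EFin \o f) ->
  (@lebesgue_measure R).-integrable [set` i] (EFin \o (fun x => k * f x)).
Proof.
move=> int_f.
have := @integrableZl _ (measurableTypeR R) _ _ _ (measurable_itv i) k _ int_f.
by apply: eq_integrable => // x _ /=; rewrite EFinM.
Qed.

Lemma integrable_fsum (R : realType) (i : interval R) (I : finType)
    (f : I -> R -> R) :
  (forall k, (@lebesgue_measure R).-integrable [set` i] (EFin \o f k)) ->
  (@lebesgue_measure R).-integrable [set` i] (EFin \o (fun x => \sum_k f k x)).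
Proof.
move=> int_f.
have := @integrable_sum _ (measurableTypeR R) _ _ _ (measurable_itv i)
  I (index_enum I) predT _ (fun k _ => int_f k).
by apply: eq_integrable => // x _ /=; rewrite sumEFin.
Qed.

Lemma integrable_add (R : realType) (i : interval R) (f g : R -> R) :
  (@lebesgue_measure R).-integrable [set` i] (EFin \o f) ->
  (@lebesgue_measure R).-integrable [set` i] (EFin \o g) ->
  (@lebesgue_measure R).-integrable [set` i] (EFin \o (fun x => f x + g x)).
Proof.
move=> int_f int_g.
have := @integrableD _ (measurableTypeR R) _ _ _ (measurable_itv i) _ _ int_f int_g.
by apply: eq_integrable => // x _ /=; rewrite EFinD.
Qed.

Lemma eq_is_derive (R : realType) (f g : R -> R) (x df dg : R) :
  f =1 g -> df = dg -> is_derive x 1 f df -> is_derive x 1 g dg.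
Proof. by move=> /funext <- <-. Qed.

Lemma is_derive_derive1 (R : realType) (f : R -> R) (x d : R) :
  is_derive x 1 f d -> derive1 f x = d.
Proof. by move=> [_ fxd]; rewrite derive1E. Qed.

(** The formula for the derivative is known only on x > 0, which is a neighbourhood of each of its
    points. *)
Lemma continuous_derive1_gt0 (R : realType) (f df : R -> R) (x : R) : 0 < x ->
  (forall y : R, 0 < y -> is_derive y 1 f (df y)) ->
  {for x, continuous df} -> {for x, continuous (derive1 f)}.
Proof.
move=> x0 fdf cdf.
rewrite /prop_for /continuous_at (is_derive_derive1 (fdf x x0)).
apply: cvg_trans cdf; apply: near_eq_cvg; near=> y.
apply/esym/is_derive_derive1/fdf; near: y; exact: lt_nbhsr.
Unshelve. all: by end_near. Qed.

Lemma is_derive_continuous (R : realType) (f : R -> R) (x d : R) :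
  is_derive x 1 f d -> {for x, continuous f}.
Proof.
by move=> [dfx _]; apply: differentiable_continuous; apply/derivable1_diffP.
Qed.

Lemma squeeze_norm_cvg0 (R : realFieldType) (T : Type) (F : set_system T)
    {FF : Filter F} (f g : T -> R) :
  (\near F, `|f F| <= g F) -> g x @[x --> F] --> 0 -> f x @[x --> F] --> 0.
Proof.
move=> fg g0; have gN0 : - g x @[x --> F] --> 0.
  by rewrite -[X in _ --> X]oppr0; exact: cvgN.
by apply: squeeze_cvgr gN0 g0; apply: filterS fg => x; rewrite ler_norml.
Qed.

(** * Weights with jumps *)

(** What the rest of the proof retains of the weight, free of [lam] and [w0]. The limit of x w(x) at
    0 removes the boundary term there in the integration by parts. *)
Definition regular_weight (R : realType) (w : R -> R) : Prop :=
  [/\ (forall x, 0 < x ->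
        [/\ 0 < w x, derivable w x 1 & {for x, continuous (derive1 w)}]),
      x * w x @[x --> 0^'+] --> 0,
      (forall p : {poly R}, (@lebesgue_measure R).-integrable `[0, +oo[
         (EFin \o (fun x => p.[x] * w x))) &
      (forall p : {poly R}, w x * p.[x] @[x --> +oo] --> 0)].

Lemma laguerre_weight_regular (R : realType) (lam : R) (w0 : R -> R) :
  -1 < lam -> laguerre_type lam w0 -> regular_weight (laguerre_weight lam w0).
Proof.
move=> lamN1 [dw0 bw0 int_w woo].
have dw (y : R) : 0 < y -> is_derive y 1 (laguerre_weight lam w0)
    (y `^ lam * derive1 w0 y + w0 y * (lam * y `^ (lam - 1))).
  move=> y0; have [_ /derivableP dwy _] := dw0 y y0.
  rewrite derive1E.
  exact: (is_deriveM (is_derive1_powR lam y0) dwy).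
split => //.
- move=> x x0; have [w0x /derivableP dwx cwx] := dw0 x x0.
  split.
  + by rewrite /laguerre_weight mulr_gt0// powR_gt0.
  + by have [] := dw x x0.
  apply: (continuous_derive1_gt0 x0 dw).
  have cpow (a : R) := is_derive_continuous (is_derive1_powR a x0).
  have cw0 := is_derive_continuous dwx.
  apply: cvgD; apply: cvgM => //; first exact: cpow.
  by apply: cvgM; [exact: cvg_cst|exact: cpow].
(* Near 0, x w(x) = x^(lam + 1) w_0(x) with w_0 bounded, and lam + 1 > 0. *)
- have /ex_bound[M wM] := bw0.
  have M0 : x `^ (lam + 1) * `|M| @[x --> 0^'+] --> (0 : R).
    rewrite -[X in _ --> X](mul0r `|M|); apply: cvgM; last exact: cvg_cst.
    by apply: powR_cvg0; rewrite -ltrBlDr sub0r.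
  apply: squeeze_norm_cvg0 M0; near=> x.
  have x0 : 0 < x by [].
  rewrite /laguerre_weight mulrA normrM.
  have -> : x * x `^ lam = x `^ (lam + 1).
    by rewrite powRD ?(gt_eqF x0) ?implybT// powRr1 ?(ltW x0)// mulrC.
  rewrite ger0_norm ?powR_ge0// ler_wpM2l ?powR_ge0//.
  rewrite (le_trans _ (ler_norm _))//; near: x; exact: wM.
- move=> p.
  have := @integrable_fsum R _ 'I_(size p) _
    (fun i => integrable_scalel p`_i (int_w i)).
  apply: eq_integrable_itv => x _; rewrite horner_coef mulr_suml.
  by apply: eq_bigr => i _; rewrite mulrA.
Unshelve. all: by end_near. Qed.

Section JumpWeight.
Variables (R : realType) (w : R -> R) (m : nat).
Variables (omega : 'I_m.+1 -> R) (t : 'I_m -> R).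
Hypothesis w_regular : regular_weight w.
Hypothesis t_ge0 : forall k, 0 <= t k.
Notation mu := (@lebesgue_measure R).
Notation wh := (jump_weight w omega t).

Let jumpE (y x : R) :
  y * (omega ord0 + \sum_(k < m) omega (lift ord0 k) * heaviside (x - t k)) =
  omega ord0 * y +
  \sum_(k < m) omega (lift ord0 k) * (y * heaviside (x - t k)).
Proof.
rewrite mulrDr mulrC mulr_sumr; congr (_ + _).
by apply: eq_bigr => k _; rewrite mulrCA.
Qed.

Lemma integrable_jump (i : interval R) (f : R -> R) :
  mu.-integrable [set` i] (EFin \o (fun x => f x * w x)) ->
  mu.-integrable [set` i] (EFin \o (fun x => f x * wh x)).
Proof.
move=> int_f; apply: (@eq_integrable_itv _ _ (fun x => omega ord0 * (f x * w x) +
  \sum_(k < m) omega (lift ord0 k) * (f x * w x * heaviside (x - t k)))).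
  by move=> x _; rewrite /jump_weight [RHS]mulrA jumpE.
apply: integrable_add; first exact: integrable_scalel.
by apply: integrable_fsum => k; apply/integrable_scalel/integrable_heavisideM.
Qed.

Lemma has_improper_int_jump (F : R -> R) :
  (forall x : R, 0 < x -> derivable F x 1 /\ {for x, continuous (derive1 F)}) ->
  F 0 = 0 -> F x @[x --> 0^'+] --> 0 -> F x @[x --> +oo] --> 0 ->
  has_improper_int (fun x => derive1 F x *
    (omega ord0 + \sum_(k < m) omega (lift ord0 k) * heaviside (x - t k)))
  (- \sum_(k < m) omega (lift ord0 k) * F (t k)).
Proof.
move=> dF F0 F0r Foo.
have F_F0 : F x @[x --> 0^'+] --> F 0 by rewrite F0.
(* The constant part [omega ord0] is treated as a jump at 0, where F(0) = 0 makes its contribution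
   vanish. *)
have := has_improper_intD
  (has_improper_intZ (omega ord0)
    (has_improper_int_derive1_heaviside (lexx 0) dF F_F0 Foo))
  (has_improper_int_sum (fun k : 'I_m => has_improper_intZ (omega (lift ord0 k))
    (has_improper_int_derive1_heaviside (t_ge0 k) dF F_F0 Foo))).
rewrite F0 oppr0 mulr0 add0r.
under eq_bigr do rewrite mulrN.
rewrite sumrN; apply: has_improper_int_ext => x x0.
by rewrite jumpE [in LHS]/heaviside addr0 x0 mulr1.
Qed.

Lemma derive1_potential (x : R) : 0 < x ->
  derive1 (potential w) x = - (derive1 w x / w x).
Proof.
have [dw _ _ _] := w_regular.
move=> x0; have [wx /derivableP dwx _] := dw x x0.
apply: is_derive_derive1.
have := is_deriveN (is_derive1_comp (is_derive1_ln wx) dwx).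
by apply: eq_is_derive => //; rewrite derive1E mulrC.
Qed.

(** Put F = x f w. Since v' w = -w', one has -x v' f w = F' - (f + x f') w, and the F' part
    integrates to the jump sum. The function [f] is only C^1 because a cutoff, not just polynomials,
    is inserted later. *)
Lemma has_improper_int_potential (z : R) (f df : R -> R) :
  (forall x : R, is_derive x 1 f (df x)) -> continuous df ->
  mu.-integrable `[0, +oo[ (EFin \o (fun x => f x * w x)) ->
  mu.-integrable `[0, +oo[ (EFin \o (fun x => (f x + x * df x) * w x)) ->
  x * f x * w x @[x --> +oo] --> 0 ->
  has_improper_int (fun x => (z * derive1 (potential w) z
      - x * derive1 (potential w) x) * f x * wh x)
    (z * derive1 (potential w) z * (\int[mu]_(x in `[0, +oo[) (f x * wh x))
     - \int[mu]_(x in `[0, +oo[) ((f x + x * df x) * wh x)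
     - \sum_(k < m) omega (lift ord0 k) * (t k * f (t k) * w (t k))).
Proof.
move=> fdf cdf int_f int_df foo.
have [dw w0 _ _] := w_regular.
pose F x := x * f x * w x.
pose dF x := (f x + x * df x) * w x + x * f x * derive1 w x.
have FdF (x : R) : 0 < x -> is_derive x 1 F (dF x).
  move=> x0; have [_ /derivableP dwx _] := dw x x0.
  have dxf := is_deriveM (is_derive_id x 1) (fdf x).
  apply: (eq_is_derive _ _ (is_deriveM dxf dwx)) => //.
  by rewrite /dF derive1E /GRing.scale/= -[(_ * _) x]/(x * f x); ring.
have dF1 (x : R) : 0 < x -> derivable F x 1 /\ {for x, continuous (derive1 F)}.
  move=> x0; have [_ /derivableP dwx cdw] := dw x x0.
  split; first by have [] := FdF x x0.
  apply: (continuous_derive1_gt0 x0 FdF).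
  have cf := is_derive_continuous (fdf x).
  have cw := is_derive_continuous dwx.
  apply: cvgD; apply: cvgM => //.
    by apply: cvgD => //; apply: cvgM; [exact: cvg_id|exact: cdf].
  by apply: cvgM => //; exact: cvg_id.
have F0r : F x @[x --> 0^'+] --> 0.
  rewrite -[X in _ --> X](mulr0 (f 0)).
  rewrite (_ : F = fun x => f x * (x * w x)); last first.
    by apply/funext => x; rewrite /F; ring.
  apply: cvgM => //.
  exact/cvg_at_right_filter/(is_derive_continuous (fdf 0)).
have F0 : F 0 = 0 by rewrite /F !mul0r.
have := has_improper_intD
  (has_improper_intD
    (has_improper_intZ (z * derive1 (potential w) z)
      (has_improper_int_integrable (integrable_jump int_f)))
    (has_improper_intZ (-1) (has_improper_int_integrable (integrable_jump int_df))))
  (has_improper_int_jump dF1 F0 F0r foo).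
rewrite mulN1r; apply: has_improper_int_ext => x x0.
have [wx _ _] := dw x x0.
rewrite (is_derive_derive1 (FdF x x0)) (derive1_potential x0) /dF /jump_weight.
by field; rewrite gt_eqF.
Qed.

End JumpWeight.

(** * A cutoff around z *)

Lemma continuous_max0 (R : realType) : continuous (fun y : R => Num.max y 0).
Proof.
rewrite (_ : (fun _ => _) = fun y : R => (y + `|y|) / 2); last first.
  by apply/funext => y; rewrite maxr_absE subr0 addr0.
move=> y; apply: cvgM; last exact: cvg_cst.
by apply: cvgD; [exact: cvg_id|exact: (cvg_norm cvg_id)].
Qed.

(** Squaring removes the corner of the positive part; at 0 the difference quotient is again
    [Num.max y 0], whence the use of Caratheodory's criterion. *)
Lemma is_derive_sqr_max0 (R : realType) (x : R) :
  is_derive x 1 (fun y : R => Num.max y 0 ^+ 2) (2 * Num.max x 0).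
Proof.
have [x0|x0|->] := ltgtP x 0.
- rewrite mulr0; apply: (@near_eq_is_derive _ _ _ (cst 0)).
    near=> y; rewrite max_r ?expr0n//.
    by apply/ltW; near: y; exact: lt_nbhsl.
- apply: (@near_eq_is_derive _ _ _ (fun y : R => y ^+ 2)).
    near=> y; rewrite max_l//.
    by apply/ltW; near: y; exact: lt_nbhsr.
  apply: (eq_is_derive _ _ (is_deriveM (is_derive_id x 1) (is_derive_id x 1))) => //.
  by rewrite /GRing.scale/= !mulr1 mulr_natl mulr2n.
- rewrite mulr0; apply/is_derive1_caratheodory.
  exists (fun y => Num.max y 0); split => [y||].
  + rewrite subr0 maxxx expr0n/= subr0.
    by case: ltgtP => y0; rewrite ?mulr0 ?mul0r ?expr0n//.
  + exact: continuous_max0.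
  + by rewrite maxxx.
Unshelve. all: by end_near. Qed.

Lemma continuous_bounded_ball (R : realType) (f : R -> R) (z e : R) :
  continuous f -> exists M : R, forall x, `|z - x| <= e -> `|f x| <= M.
Proof.
move=> cf.
have /compact_bounded[M [_ fM]] : compact (f @` `[z - e, z + e]%classic).
  apply: continuous_compact; last exact: segment_compact.
  exact: continuous_subspaceT.
exists (M + 1) => x zxe; apply: (fM (M + 1)); first by rewrite ltrDl.
exists x => //=; rewrite in_itv/=.
by move: zxe; rewrite distrC ler_distl.
Qed.

(* The witness is [1 / (z - x) = (z - x) / q] with [q = (z - x)^2], whose
   denominator is made positive at [z] by a [C^1] term vanishing off the ball. *)
Lemma exists_cutoff (R : realType) (z e : R) : 0 < e ->
  exists f df : R -> R, exists M : R,
  [/\ forall x : R, is_derive x 1 f (df x), continuous df,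
      forall x, `|f x| <= M, forall x, `|f x + x * df x| <= M &
      forall x, e <= `|z - x| -> (z - x) * f x = 1].
Proof.
move=> e0.
pose q x := (z - x) ^+ 2.
pose D x := q x + Num.max (e ^+ 2 - q x) 0 ^+ 2.
pose dD x := - 2 * (z - x) + 2 * Num.max (e ^+ 2 - q x) 0 * (2 * (z - x)).
(* Away from z the term q is positive; at z the other term equals e^4. *)
have D_gt0 x : 0 < D x.
  rewrite /D; have [qe|qe] := ltP (e ^+ 2) (q x).
    by rewrite ltr_wpDr ?sqr_ge0// (lt_trans _ qe)// exprn_gt0.
  have [q0|q0] := eqVneq (q x) 0.
    by rewrite q0 subr0 add0r exprn_gt0// lt_max exprn_gt0.
  by rewrite ltr_wpDr ?sqr_ge0// lt_neqAle eq_sym q0 sqr_ge0.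
have D_neq0 x : D x != 0 by exact: lt0r_neq0.
have qdq (x : R) : is_derive x 1 q (- 2 * (z - x)).
  have dzx := is_deriveB (is_derive_cst z x 1) (is_derive_id x 1).
  apply: (eq_is_derive _ _ (is_deriveM dzx dzx)) => //.
  by rewrite /GRing.scale/= -[(_ - _) x]/(z - x); ring.
have DdD (x : R) : is_derive x 1 D (dD x).
  have h := @is_derive1_comp _ _ (fun x => e ^+ 2 - q x) _ _ _
    (is_derive_sqr_max0 _) (is_deriveB (is_derive_cst (e ^+ 2) x 1) (qdq x)).
  apply: (eq_is_derive _ _ (is_deriveD (qdq x) h)) => //.
  by rewrite /dD; ring.
pose f x := (z - x) / D x.
pose df x := - (D x)^-1 - (z - x) * dD x / D x ^+ 2.
have fdf (x : R) : is_derive x 1 f (df x).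
  have h := is_deriveV (D_neq0 x) (DdD x).
  apply: (eq_is_derive _ _ (is_deriveM
    (is_deriveB (is_derive_cst z x 1) (is_derive_id x 1)) h)) => //.
  rewrite /df /GRing.scale/= -[(_ - _) x]/(z - x).
  by field; rewrite D_neq0.
have cf : continuous f by move=> x; exact: is_derive_continuous (fdf x).
have cD : continuous D by move=> x; exact: is_derive_continuous (DdD x).
have czx : continuous (fun x => z - x).
  by move=> x; apply: cvgB; [exact: cvg_cst|exact: cvg_id].
have cq : continuous q by move=> x; exact: is_derive_continuous (qdq x).
have cdD : continuous dD.
  move=> x; apply: cvgD; apply: cvgM; try exact: cvg_cst; try exact: czx.
    apply: cvgM; first exact: cvg_cst.
    apply: (@continuous_comp _ _ _ (fun y => e ^+ 2 - q y)
      (fun y : R => Num.max y 0)); last exact: continuous_max0.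
    by apply: cvgB; [exact: cvg_cst|exact: cq].
  by apply: cvgM; [exact: cvg_cst|exact: czx].
have cdf : continuous df.
  move=> x; apply: cvgB.
    by apply: cvgN; apply: cvgV; [exact: D_neq0|exact: cD].
  apply: cvgM; first by apply: cvgM; [exact: czx|exact: cdD].
  apply: cvgV; first by rewrite expf_neq0// D_neq0.
  by apply: cvgM; exact: cD.
have max_out x : e <= `|z - x| -> Num.max (e ^+ 2 - q x) 0 = 0.
  move=> ezx; rewrite max_r// subr_le0 /q -[leRHS]real_normK ?num_real//.
  by rewrite lerXn2r ?nnegrE ?(ltW e0).
have f_out x : e <= `|z - x| -> (z - x) * f x = 1.
  move=> ezx; rewrite /f /D max_out// expr0n/= addr0 mulrA divff//.
  by rewrite sqrf_eq0 -normr_gt0 (lt_le_trans e0).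
(* Off the ball f = 1 / (z - x), hence f + x f' = z / (z - x)^2. *)
have g_out x : e <= `|z - x| -> (f x + x * df x) * (z - x) ^+ 2 = z.
  move=> ezx; have zx0 : z - x != 0 by rewrite -normr_gt0 (lt_le_trans e0).
  rewrite /df /f /dD /D max_out// /q.
  by field.
have [M1 fM1] := continuous_bounded_ball z e cf.
have cg : continuous (fun x => f x + x * df x).
  by move=> x; apply: cvgD => //; [exact: cf|apply: cvgM; [exact: cvg_id|exact: cdf]].
have [M2 gM2] := continuous_bounded_ball z e cg.
have e1 : 0 <= e^-1 by rewrite invr_ge0 ltW.
have ze2 : 0 <= `|z| / e ^+ 2 by rewrite divr_ge0 ?sqr_ge0.
(* [M1] and [M2] bound f and f + x f' on the closed ball, by compactness; the last two summands
   bound them outside it. *)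
exists f, df, (`|M1| + `|M2| + e^-1 + `|z| / e ^+ 2); split => // x.
- have [ezx|/ltW zxe] := leP e `|z - x|.
    have : `|f x| <= e^-1.
      have zx0 : 0 < `|z - x| by exact: lt_le_trans ezx.
      have -> : f x = (z - x)^-1.
        by apply: (@mulfI _ (z - x)); rewrite -?normr_gt0// f_out// divff -?normr_gt0.
      by rewrite normfV lef_pV2.
    by have := normr_ge0 M1; have := normr_ge0 M2; lra.
  have := fM1 x zxe; have := ler_norm M1; have := normr_ge0 M2; lra.
- have [ezx|/ltW zxe] := leP e `|z - x|.
    have : `|f x + x * df x| <= `|z| / e ^+ 2.
      rewrite ler_pdivlMr ?exprn_gt0// -[in leRHS](g_out x ezx) normrM normrX.
      by rewrite ler_wpM2l// lerXn2r ?nnegrE ?(ltW e0).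
    by have := normr_ge0 M1; have := normr_ge0 M2; lra.
  have := gM2 x zxe; have := ler_norm M2; have := normr_ge0 M1; lra.
Qed.

(** * The functional M *)

Lemma integrable_bounded_mull (R : realType)
    (D : set (measurableTypeR R)) (f g : R -> R) (M : R) :
  measurable D -> continuous f -> (forall x, D x -> `|f x| <= M) ->
  (@lebesgue_measure R).-integrable D (EFin \o g) ->
  (@lebesgue_measure R).-integrable D (EFin \o (fun x => f x * g x)).
Proof.
move=> mD cf fM int_g.
have mf : measurable_fun D (f : measurableTypeR R -> R).
  by apply: measurable_funTS; exact: continuous_measurable_fun.
have bf : [bounded f x | x in D].
  exists M; split; first exact: num_real.
  by move=> y My x /fM/le_trans; apply; exact: ltW.
have := @integrableMr _ (measurableTypeR R) _ _ D mD f (EFin \o g) mf bf int_g.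
by apply: eq_integrable => // x _ /=; rewrite EFinM.
Qed.

(** Turns functionals given by integrals into the bundled linear forms that the algebraic identities
    take. *)
Lemma exists_scalar (F : fieldType) (f : {poly F} -> F) :
  (forall c p q, f (c *: p + q) = c * f p + f q) ->
  exists L : {scalar {poly F}}, L =1 f.
Proof.
move=> f_lin.
pose L : {scalar {poly F}} := HB.pack f (GRing.isLinear.Build _ _ _ _ f f_lin).
by exists L.
Qed.

Section LadderFunctional.
Variables (R : realType) (w : R -> R) (m : nat).
Variables (omega : 'I_m.+1 -> R) (t : 'I_m -> R) (z : R).
Hypothesis w_regular : regular_weight w.
Hypothesis t_ge0 : forall k, 0 <= t k.
Notation mu := (@lebesgue_measure R).
Notation wh := (jump_weight w omega t).
Notation v := (potential w).
Notation K := (ladder_kernel v z).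
Notation L p := (\int[mu]_(x in `[0, +oo[) (p.[x] * wh x)).

Lemma ladder_kernelM x : K x * (z - x) = z * derive1 v z - x * derive1 v x.
Proof.
(* At x = z both sides are 0, whatever value the quotient has there. *)
have [->|xz] := eqVneq x z; first by rewrite !subrr mulr0.
by rewrite /ladder_kernel divfK// subr_eq0 eq_sym.
Qed.

Lemma integrable_poly_jump (p : {poly R}) :
  mu.-integrable `[0, +oo[ (EFin \o (fun x => p.[x] * wh x)).
Proof. by have [_ _ int_w _] := w_regular; exact: integrable_jump. Qed.

Lemma integral_poly_linear (c : R) (p q : {poly R}) :
  L (c *: p + q) = c * L p + L q.
Proof.
have mI : measurable (`[0%R, +oo[%classic : set (measurableTypeR R)).
  exact: measurable_itv.
have int_cp := integrable_scalel c (integrable_poly_jump p).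
rewrite -RintegralZl//; last exact: integrable_poly_jump.
rewrite -(RintegralD mI int_cp (integrable_poly_jump q)).
by apply: eq_Rintegral => x _; rewrite hornerD hornerZ; ring.
Qed.

(** The factor z - x clears the denominator of the kernel, so nothing has to be assumed near x =
    z. *)
Lemma has_improper_int_kernelM (S : {poly R}) :
  has_improper_int (fun x => K x * ((z%:P - 'X) * S).[x] * wh x)
    (z * derive1 v z * L S - L ('X * S)^`()
     - \sum_(k < m) omega (lift ord0 k) * (t k * S.[t k] * w (t k))).
Proof.
have [_ _ int_w woo] := w_regular.
have dXS x : S.[x] + x * S^`().[x] = (('X * S)^`()).[x].
  by rewrite derivM derivX mul1r hornerD hornerM hornerX.
have h := @has_improper_int_potential R w m omega t w_regular t_ge0 z
  (horner S) (horner S^`()) (is_derive_poly S) (@continuous_horner _ _) (int_w S).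
have hE : (fun x => (S.[x] + x * S^`().[x]) * w x) =
    (fun x => (('X * S)^`()).[x] * w x).
  by apply/funext => x; rewrite dXS.
have foo : x * S.[x] * w x @[x --> +oo] --> 0.
  have := woo ('X * S).
  rewrite (_ : (fun x => w x * _) = (fun x => x * S.[x] * w x))//.
  by apply/funext => x; rewrite hornerM hornerX mulrC.
have {}h := h _ foo.
rewrite hE in h; have {h} := h (int_w _).
have -> : \int[mu]_(x in `[0, +oo[) ((S.[x] + x * S^`().[x]) * wh x) = L ('X * S)^`().
  by apply: eq_Rintegral => x _; rewrite dXS.
apply: has_improper_int_ext => x _.
by rewrite -ladder_kernelM hornerM hornerD hornerN hornerC hornerX; ring.
Qed.

Lemma has_improper_int_kernel1 (e : R) : 0 < e ->
  mu.-integrable (ball z e) (EFin \o (fun x => K x * wh x)) ->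
  exists c, has_improper_int (fun x => K x * wh x) c.
Proof.
move=> e0 int_K.
have [_ _ int_w woo] := w_regular.
have [f [df [M [fdf cdf fM gM f_out]]]] := exists_cutoff z e0.
have cf : continuous f by move=> x; exact: is_derive_continuous (fdf x).
have mI : measurable (`[0%R, +oo[%classic : set (measurableTypeR R)).
  exact: measurable_itv.
have mB : measurable (ball z e : set (measurableTypeR R)).
  exact: measurable_ball.
have int_w1 : mu.-integrable `[0, +oo[ (EFin \o w).
  by apply: eq_integrable_itv (int_w 1) => x _; rewrite hornerC mul1r.
have M0 : 0 <= M by exact: le_trans (fM 0).
pose chi x := 1 - (z - x) * f x.
have cchi : continuous chi.
  move=> x; apply: cvgB; first exact: cvg_cst.
  apply: cvgM; last exact: cf.
  by apply: cvgB; [exact: cvg_cst|exact: cvg_id].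
have chi_out x : ~ ball z e x -> chi x = 0.
  by move=> /negP; rewrite /ball/= -leNgt => /f_out; rewrite /chi => ->; rewrite subrr.
(* As [chi] vanishes off the ball, integrability there extends by zero to the whole line and then
   restricts to the half line. *)
have int_chi : mu.-integrable `[0, +oo[ (EFin \o (fun x => chi x * (K x * wh x))).
  apply: (@integrableS _ (measurableTypeR R) _ mu setT) => //.
  have chiM x : ball z e x -> `|chi x| <= 1 + e * M.
    rewrite /ball/= => zx; rewrite (le_trans (ler_normB _ _))// normr1 lerD2l.
    by rewrite normrM ler_pM// ltW.
  have := integrable_bounded_mull mB cchi chiM int_K.
  move=> /(integrable_mkcond _ mB).1.
  congr (integrable _ _ _); apply/funext => x.
  rewrite patchE; case: ifPn => //; rewrite notin_setE => /chi_out /= ->.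
  by rewrite mul0r.
have h1 := has_improper_int_integrable int_chi.
(* Since |f| is at most M, the decay of x w(x) suffices. *)
have foo : x * f x * w x @[x --> +oo] --> 0.
  have M1 : M * `|w x * ('X : {poly R}).[x]| @[x --> +oo] --> 0.
    rewrite -[X in _ --> X](mulr0 M); apply: cvgM; first exact: cvg_cst.
    by rewrite -[X in _ --> X](normr0 R); apply: cvg_norm; exact: woo.
  apply: squeeze_norm_cvg0 M1; near=> x.
  rewrite hornerX mulrAC normrM mulrC ler_pM// mulrC//.
have cg : continuous (fun x => f x + x * df x).
  by move=> x; apply: cvgD => //; [exact: cf|apply: cvgM; [exact: cvg_id|exact: cdf]].
have h2 := has_improper_int_potential omega w_regular t_ge0 z fdf cdf
  (integrable_bounded_mull mI cf (fun x _ => fM x) int_w1)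
  (integrable_bounded_mull mI cg (fun x _ => gM x) int_w1) foo.
eexists; apply: has_improper_int_ext (has_improper_intD h1 h2) => x _.
by rewrite -ladder_kernelM /chi; ring.
Unshelve. all: by end_near. Qed.

Lemma ladder_functional (e : R) : 0 < e ->
  mu.-integrable (ball z e) (EFin \o (fun x => K x * wh x)) ->
  exists M : {scalar {poly R}},
    (forall p : {poly R}, has_improper_int (fun x => K x * p.[x] * wh x) (M p)) /\
    (forall S : {poly R}, M ((z%:P - 'X) * S) =
      z * derive1 v z * L S - L ('X * S)^`()
      - \sum_(k < m) omega (lift ord0 k) * (t k * S.[t k] * w (t k))).
Proof.
move=> e0 /(has_improper_int_kernel1 e0)[c hc].
pose f p := improper_int (fun x => K x * p.[x] * wh x).
have hf (p : {poly R}) : has_improper_int (fun x => K x * p.[x] * wh x) (f p).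
  (* Splitting p = p(z) + (X - z) S reduces every polynomial to the constant 1 and to a multiple of
     z - X. *)
  have /factor_theorem[S pS] : root (p - (p.[z])%:P) z.
    by apply/rootP; rewrite hornerD hornerN hornerC subrr.
  have hp := has_improper_intD (has_improper_intZ p.[z] hc)
    (has_improper_int_kernelM (- S)).
  set l := (X in has_improper_int _ X) in hp.
  suff hp' : has_improper_int (fun x => K x * p.[x] * wh x) l.
    by rewrite /f (has_improper_intE hp').
  apply: has_improper_int_ext hp => x _.
  have -> : p.[x] = p.[z] + ((z%:P - 'X) * - S).[x].
    by rewrite mulrN -mulNr opprB mulrC -pS hornerD hornerN hornerC addrC subrK.
  by ring.
have f_lin (a : R) (p q : {poly R}) : f (a *: p + q) = a * f p + f q.
  apply: has_improper_intE.
  have hpq := has_improper_intD (has_improper_intZ a (hf p)) (hf q).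
  apply: has_improper_int_ext hpq => x _.
  by rewrite hornerD hornerZ; ring.
have [M Mf] := exists_scalar f_lin.
exists M; split=> [p|S]; rewrite Mf; first exact: hf.
exact/has_improper_intE/has_improper_int_kernelM.
Qed.

End LadderFunctional.

(** * The ladder relations for the jump weight *)

Theorem theorem3p4 (R : realType) (lam : R) (w0 : R -> R)
    (m : nat) (omega : 'I_m.+1 -> R) (t : 'I_m -> R)
    (P : nat -> {poly R}) (h : nat -> R) (z : R) :
  let w := laguerre_weight lam w0 in
  let v := potential w in
  let wh := jump_weight w omega t in
  let A := ladderA w omega t P h in
  let B := ladderB w omega t P h in
  -1 < lam ->
  laguerre_type lam w0 ->
  (forall k, 0 <= t k) ->
  (forall k l : 'I_m, (k < l)%N -> t k < t l) ->
  (forall l : 'I_m.+1, 0 <= \sum_(k < m.+1 | (k <= l)%N) omega k) ->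
  monic_orthogonal wh P h ->
  0 < z ->
  (forall k, z != t k) ->
  (* the integrands of A_n(z) and B_n(z) are integrable across x = z *)
  (exists2 e : R, 0 < e &
     (@lebesgue_measure R).-integrable (ball z e)
       (EFin \o (fun x => ladder_kernel v z x * wh x))) ->
  forall n : nat,
    [/\ improper_cvg (integrandA w omega t P n z),
        improper_cvg (integrandB w omega t P n z),
        (P n)^`().[z] = - B n z * (P n).[z]
                        + beta h n * A n z * (preceding P n).[z] &
        (preceding P n)^`().[z] = (B n z + derive1 v z) * (preceding P n).[z]
                             - preceding (A^~ z) n * (P n).[z]].
Proof.
move=> w v wh A B lamN1 w_laguerre t0 _ _ [P_prop h0 ortho] z0 zt [e e0 int_K] n.
have w_reg : regular_weight w := laguerre_weight_regular lamN1 w_laguerre.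
have [M0 [M0_int M0_mul]] := ladder_functional w_reg t0 e0 int_K.
have [L LE] := exists_scalar (integral_poly_linear omega t w_reg).
have L_ortho i j : L (P i * P j) = h j * (i == j)%:R.
  rewrite LE -ortho; apply: eq_Rintegral => x _; by rewrite hornerM.
(* On p = (z - X) S the correction [d k * p.[t k] / (z - t k)] is omega_k t_k w(t_k) S(t_k), which
   cancels the k-th jump term in [M0_mul]. *)
pose d k := omega (lift ord0 k) * w (t k) * t k.
have [M ME] : exists M : {scalar {poly R}}, M =1
    fun p => M0 p + \sum_(k < m) d k * p.[t k] / (z - t k).
  apply: exists_scalar => c p q; rewrite linearP/= mulrDr mulr_sumr addrACA.
  congr (_ + _); rewrite -big_split/=; apply: eq_bigr => k _.
  by rewrite hornerD hornerZ; ring.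
have zt0 k : z - t k != 0 by rewrite subr_eq0.
have M_mul (S : {poly R}) :
    M ((z%:P - 'X) * S) = z * derive1 v z * L S - L ('X * S)^`().
  rewrite ME M0_mul !LE -addrA -[RHS]addr0; congr (_ + _).
  rewrite addrC; apply/eqP; rewrite subr_eq0; apply/eqP; apply: eq_bigr => k _.
  rewrite hornerM hornerD hornerN hornerC hornerX /d.
  by field; exact: zt0.
have P_monic j : P j \is monic by have [] := P_prop j.
have size_P j : size (P j) = j.+1 by have [] := P_prop j.
have A_int k : has_improper_int (integrandA w omega t P k z) (M0 (P k ^+ 2)).
  apply: has_improper_int_ext (M0_int _) => x _.
  by rewrite /integrandA horner_exp.
have B_int k : has_improper_int (integrandB w omega t P k z)
    (M0 (preceding P k * P k)).
  apply: has_improper_int_ext (M0_int _) => x _.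
  by rewrite hornerM /integrandB; ring.
(* From 1 / (z - t) - 1 / z = t / (z (z - t)): the subtracted sum in the bracket is the source of
   the factor t_k in [d]. *)
have sumE (r : 'I_m -> R) : z^-1 * - (\sum_k r k) + \sum_k r k / (z - t k) =
    z^-1 * \sum_k r k * t k / (z - t k).
  rewrite mulrN mulr_sumr -sumrN -big_split/= mulr_sumr.
  apply: eq_bigr => k _; by field; rewrite zt0 gt_eqF.
have AE k : A k z = (z * h k)^-1 * M (P k ^+ 2).
  rewrite /A /ladderA (has_improper_intE (A_int k)) mulrDr -addrA sumE ME.
  rewrite invfM mulrDr mulrA; congr (_ + _).
  rewrite -mulrA; congr (_ * _); rewrite mulr_sumr; apply: eq_bigr => j _.
  by rewrite /jumpR /d horner_exp; field; rewrite h0 zt0.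
have BE k : B k.+1 z = (z * h k)^-1 * (M (P k * P k.+1) - k.+1%:R * h k).
  rewrite /B /ladderB (has_improper_intE (B_int _)) ME/=.
  rewrite [X in z^-1 * X]addrAC mulrDr -addrA sumE.
  rewrite [in RHS]mulrDr [in RHS]mulrDr invfM.
  have -> : z^-1 * (\sum_(j < m) jumpr w omega t P h k.+1 j * t j / (z - t j)) =
      z^-1 / h k * \sum_(j < m) d j * (P k * P k.+1).[t j] / (z - t j).
    rewrite -mulrA; congr (_ * _); rewrite mulr_sumr; apply: eq_bigr => j _.
    by rewrite /jumpr /d/= hornerM; field; rewrite h0 zt0.
  by field; rewrite h0 gt_eqF.
have zh0 k : z * h k != 0 by rewrite mulf_neq0// gt_eqF.
split.
- exact: has_improper_int_cvg (A_int n).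
- exact: has_improper_int_cvg (B_int n).
(* For n = 0 the polynomial P_0 is constant, and [preceding P 0], [beta h 0] and [B 0 z] are all 0
   by definition. *)
- case: n => [|n].
    rewrite /=; have /size_poly1P[c _ ->] : size (P 0) == 1%N by rewrite size_P.
    by rewrite derivC horner0; ring.
  have := lowering_identity P_monic size_P h0 L_ortho M_mul n.
  (* The factor h_(n+1) of beta cancels against the one in A_(n+1), so both sides share the
     denominator z h_n. *)
  rewrite AE BE /beta /preceding => E; apply: (mulfI (zh0 n)); rewrite E.
  by field; rewrite !h0 gt_eqF.
- case: n => [|n]; first by rewrite /= deriv0 !horner0; ring.
  have := raising_identity P_monic size_P h0 L_ortho M_mul n.
  rewrite /preceding AE BE => E; apply: (mulfI (zh0 n)); rewrite E.
  by field; rewrite !h0 gt_eqF.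
Qed.
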